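(* Let $n\ge 3$ and let $\overleftrightarrow{C_n}$ be the bidirected cycle on vertices $v_0,\dots,v_{n-1}$ (indices modulo $n$), in which each clockwise edge $(v_i,v_{i+1})$ has weight $p>0$ and each counterclockwise edge $(v_i,v_{i-1})$ has weight $q>0$. Let the initial blue set $B_0$ consist of $k\ge 1$ consecutive vertices in $\overleftrightarrow{C_n}$. Then $$\operatorname{ept}_{\mathrm{rzf}}(\overleftrightarrow{C_n},B_0)=n-k.$$ In particular, the expected propagation time is independent of the weights $p$ and $q$.
   Context: Randomized zero forcing (RZF): $G$ is a finite directed graph with nonnegative weights $w_{uv}$ on directed edges $(u,v)$, with $w_{uv}=0$ if there is no edge from $u$ to $v$. Start with blue set $B_0$. Given the blue set $B_t$, each white vertex $w\notin B_t$ independently becomes blue at round $t+1$ with probability $p_t(w)=\frac{\sum_{u\in B_t}w_{uw}}{\sum_{u\in V(G)}w_{uw}}$ if the denominator is positive, and $p_t(w)=0$ otherwise; blue vertices stay blue forever. Expected propagation time: if it is possible (with positive probability) to color all of $G$ blue starting from $B_0$, then $\operatorname{ept}_{\mathrm{rzf}}(G,B_0)$ is the expected value of $\tau=\min\{t: B_t=V(G)\}$; otherwise it is $\infty$. *)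

(* Defs.v *)
From HB Require Import structures.
From mathcomp Require Import all_boot all_order all_algebra.
From mathcomp Require Import all_classical all_reals all_analysis.

Set Implicit Arguments.
Unset Strict Implicit.
Unset Printing Implicit Defensive.

Import Order.TTheory GRing.Theory Num.Theory.
Import numFieldNormedType.Exports.

Local Open Scope classical_set_scope.
Local Open Scope ring_scope.

(* A weighted digraph on V is given by its weights: [w u v] is the weight of
   the edge from u to v, and is 0 when there is no such edge. *)
Section RandomizedZeroForcing.
Context (R : realType) (V : finType) (w : V -> V -> R).

Definition blue_prob (B : {set V}) (v : V) : R :=
  if 0 < \sum_u w u v then (\sum_(u in B) w u v) / (\sum_u w u v) else 0.

(* Probability that the next blue set is exactly B' when the current one is B:
   blue vertices stay blue, and the white ones turn blue independently. *)
Definition rzf_step (B B' : {set V}) : R :=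
  if B \subset B' then
    \prod_(v | v \notin B)
      (if v \in B' then blue_prob B v else 1 - blue_prob B v)
  else 0.

(* The third field is the transition rule conditionally on the whole past
   h 0, ..., h t, multiplied out so that histories of probability 0 are
   harmless. *)
Record rzf_process d (Omega : measurableType d) (P : probability Omega R)
    (B0 : {set V}) (B : nat -> Omega -> {set V}) : Prop := RzfProcess {
  rzf_measurable : forall t S, measurable [set x | B t x = S];
  rzf_init : P [set x | B 0%N x = B0] = 1%E;
  rzf_trans : forall t (h : nat -> {set V}),
    P [set x | forall s, (s <= t.+1)%N -> B s x = h s] =
    (P [set x | forall s, (s <= t)%N -> B s x = h s]
       * (rzf_step (h t) (h t.+1))%:E)%E }.

End RandomizedZeroForcing.

Section PropagationTime.
Context d (Omega : measurableType d) (R : realType) (P : probability Omega R).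
Context (V : finType) (B : nat -> Omega -> {set V}).

(* min {t | B_t = V}, which is +oo = ereal_inf set0 if there is no such t *)
Definition prop_time (x : Omega) : \bar R :=
  ereal_inf [set t%:R%:E | t in [set t | B t x = [set: V]%SET]].

(* The integral is the expectation of prop_time; the library's 'E_P[_] only
   takes functions with finite values. *)
Definition ept_rzf : \bar R :=
  if `[< exists t, (0 < P [set x | B t x = [set: V]%SET])%E >]
  then (\int[P]_x prop_time x)%E else +oo%E.

End PropagationTime.

(* Vertex v_i of the cycle is i : 'I_n; [ordS] and [ord_pred] are i |-> i + 1
   and i |-> i - 1 modulo n, which differ when n >= 3. *)
Definition bicycle (R : realType) (n : nat) (p q : R) (u v : 'I_n) : R :=
  if v == ordS u then p else if v == ord_pred u then q else 0.

(* v_a, v_(a+1), ..., v_(a+k-1) *)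
Definition cycle_arc (n : nat) (a : 'I_n) (k : nat) : {set 'I_n} :=
  [set iter j (@ordS n) a | j : 'I_k]%SET.

Module RzfExistence.

Lemma blue_prob_ge0_le1 (R : realType) (V : finType) (w : V -> V -> R)
    (w_ge0 : forall u v, 0 <= w u v) B v : 0 <= blue_prob w B v <= 1.
Proof.
rewrite /blue_prob; case: ifPn => [D0|_]; last by rewrite lexx ler01.
rewrite divr_ge0 ?sumr_ge0//= ler_pdivrMr// mul1r.
rewrite [leRHS](bigID (mem B))/= lerDl sumr_ge0//.
Qed.

Lemma rzf_step_ge0 (R : realType) (V : finType) (w : V -> V -> R)
    (w_ge0 : forall u v, 0 <= w u v) B B' : 0 <= rzf_step w B B'.
Proof.
rewrite /rzf_step; case: ifPn => // _; apply: prodr_ge0 => v _.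
have /andP[? ?] := blue_prob_ge0_le1 w_ge0 B v.
by case: ifPn => // _; rewrite subr_ge0.
Qed.

Lemma rzf_step_sum (R : realType) (V : finType) (w : V -> V -> R) B :
  \sum_(B' : {set V}) rzf_step w B B' = 1.
Proof.
pose F v := if v \in B then 1 else blue_prob w B v.
pose G v := if v \in B then 0 else 1 - blue_prob w B v.
have -> : 1 = \prod_v (F v + G v).
  rewrite big1// => v _; rewrite /F /G; case: ifP => _; first by rewrite addr0.
  by rewrite addrC subrK.
rewrite bigA_distr; apply: eq_bigr => B' _; rewrite /rzf_step.
rewrite [RHS](bigID (mem B))/=; case: ifPn => BB'.
  rewrite [X in X * _]big1 ?mul1r => [|v vB]; last first.
    by rewrite (fintype.subsetP BB' v vB) /F vB.
  by apply: eq_bigr => v /negbTE vB; rewrite /F /G vB.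
have /subsetPn[v vB vB'] := BB'.
by rewrite (bigD1 v)//= (negbTE vB') /G vB !mul0r.
Qed.

(* A chain with initial state s0 and transition matrix K, on [0, 1[ with the
   uniform probability: [cell h t] is the (left end, length) of the interval of
   the points whose first t + 1 states are h 0, ..., h t. *)
Section Chain.
Context (R : realType) (S : finType) (K : S -> S -> R) (s0 : S).
Context (K_ge0 : forall s s', 0 <= K s s').
Context (K_sum : forall s, \sum_s' K s s' = 1).

Let c s i := \sum_(0 <= j < i) K s (nth s0 (enum S) j).
Let idx (s : S) := index s (enum S).

Let cS s s' : c s (idx s').+1 = c s (idx s') + K s s'.
Proof. by rewrite /c big_nat_recr//= nth_index ?mem_enum. Qed.

Let c_mono s : {homo c s : i j / (i <= j)%N >-> i <= j}.
Proof.
move=> i j ij; rewrite /c [leRHS](big_cat_nat (leq0n i) ij)/= lerDl.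
by apply: sumr_ge0.
Qed.

Let c_last s : c s #|S| = 1.
Proof.
by rewrite /c cardE -(big_nth s0 xpredT (K s)) big_enum.
Qed.

Definition chain_in (x : R) (l : R * R) s s' :=
  l.1 + l.2 * c s (idx s') <= x < l.1 + l.2 * c s (idx s').+1.

Fixpoint chain_st (x : R) t : S * (R * R) :=
  if t is t'.+1 then
    let: (s, l) := chain_st x t' in
    let s' := odflt s [pick s' | chain_in x l s s'] in
    (s', (l.1 + l.2 * c s (idx s'), l.2 * K s s'))
  else (s0, (0, 1)).

Definition chain t (x : R) : S := if 0 <= x < 1 then (chain_st x t).1 else s0.

Fixpoint cell (h : nat -> S) t : R * R :=
  if t is t'.+1 then
    let: l := cell h t' in
    (l.1 + l.2 * c (h t') (idx (h t)), l.2 * K (h t') (h t))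
  else (0, 1).

Let c_ge0 s i : 0 <= c s i. Proof. exact: sumr_ge0. Qed.

Let chain_in_ex x l s : l.1 <= x < l.1 + l.2 -> exists s', chain_in x l s s'.
Proof.
move=> /andP[l1 l2].
suff H i : x < l.1 + l.2 * c s i -> (i <= #|S|)%N ->
    exists s', chain_in x l s s'.
  by apply: (H #|S|) => //; rewrite c_last mulr1.
elim: i => [|i IH] xi iS.
  by move: xi; rewrite /c big_geq// mulr0 addr0 ltNge l1.
have [xlt|xge] := ltP x (l.1 + l.2 * c s i); first exact: IH xlt (ltnW iS).
exists (nth s0 (enum S) i).
by rewrite /chain_in /idx index_uniq ?enum_uniq -?cardE// xge xi.
Qed.

Let chain_in_inj x l s s' s'' : 0 <= l.2 -> chain_in x l s s' -> chain_in x l s s'' ->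
  s' = s''.
Proof.
move=> l2 /andP[a b] /andP[a' b'].
have H i j : l.1 + l.2 * c s i <= x -> x < l.1 + l.2 * c s j.+1 -> (i <= j)%N.
  move=> xi xj; rewrite leqNgt; apply/negP => ji.
  have := le_lt_trans xi xj; rewrite ltNge lerD2l => /negP; apply.
  by rewrite ler_wpM2l// c_mono.
have ii : idx s' = idx s'' by apply/eqP; rewrite eqn_leq !H.
by rewrite -(nth_index s0 (mem_enum S s')) -/(idx s') ii nth_index ?mem_enum.
Qed.

Let cell_ge0 h t : 0 <= (cell h t).2.
Proof. by elim: t => //= t IH; rewrite mulr_ge0. Qed.

Let cell_bnd h t : 0 <= (cell h t).1 /\ (cell h t).1 + (cell h t).2 <= 1.
Proof.
elim: t => /= [|t [a b]]; first by rewrite add0r.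
split; first by rewrite addr_ge0// mulr_ge0.
rewrite -addrA -mulrDr -cS; apply: le_trans b; rewrite lerD2l.
rewrite -[leRHS]mulr1 ler_wpM2l// -(c_last (h t)) c_mono//.
by rewrite /idx cardE index_mem mem_enum.
Qed.

Let chain_st_cell h t x : (forall s, (s <= t)%N -> (chain_st x s).1 = h s) ->
  chain_st x t = (h t, cell h t).
Proof.
elim: t => [|t IH] H; first by rewrite /= -(H 0%N).
have := H t.+1 (leqnn _); rewrite /= IH => [|s st]; last by apply: H; rewrite leqW.
by move=> /= ->.
Qed.

Let in_cell h t x : 0 <= x < 1 -> h 0%N = s0 ->
  (forall s, (s <= t)%N -> (chain_st x s).1 = h s) <->
  (cell h t).1 <= x < (cell h t).1 + (cell h t).2.
Proof.
move=> x01 h0; elim: t => [|t IH].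
  split=> [_ /=|_ s]; first by rewrite add0r.
  by rewrite leqn0 => /eqP ->.
have cellS : (cell h t.+1).1 <= x < (cell h t.+1).1 + (cell h t.+1).2 =
             chain_in x (cell h t) (h t) (h t.+1).
  by rewrite /chain_in cS mulrDr addrA.
rewrite cellS; split=> [H|xin].
  have Ht : forall s, (s <= t)%N -> (chain_st x s).1 = h s.
    by move=> s st; apply: H; exact: leqW.
  have := H _ (leqnn t.+1); rewrite /= (chain_st_cell Ht)/=.
  case: pickP => /= [s' xs' <-//|].
  by have [s' xs' /(_ s')] := chain_in_ex (h t) (IH.1 Ht); rewrite xs'.
have Ht : forall s, (s <= t)%N -> (chain_st x s).1 = h s.
  apply: IH.2; move: xin => /andP[a b].
  apply/andP; split; first by apply: le_trans a; rewrite lerDl mulr_ge0.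
  apply: lt_le_trans b _; rewrite lerD2l -[leRHS]mulr1 ler_wpM2l//.
  by rewrite -(c_last (h t)) c_mono// /idx cardE index_mem mem_enum.
move=> s; rewrite leq_eqVlt => /predU1P[->|]; last by rewrite ltnS; exact: Ht.
rewrite /= (chain_st_cell Ht)/=; case: pickP => /= [s' xs'|/(_ (h t.+1))].
  exact: chain_in_inj (cell_ge0 h t) xs' xin.
by rewrite xin.
Qed.

Let E h t := [set x | forall s, (s <= t)%N -> chain s x = h s].

Let E_out h t : E h t `\` `[0, 1[ =
  if `[< forall s, (s <= t)%N -> s0 = h s >] then ~` `[0, 1[ else set0.
Proof.
have ch x s : ~ `[0, 1[%classic x -> chain s x = s0.
  by rewrite /chain /= in_itv/=; case: ifP.
apply/seteqP; split=> x.
  move=> [Ex x01]; case: asboolP => // nE; exfalso; apply: nE => s st.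
  by rewrite -(Ex s st) ch.
by case: asboolP => // Hs x01; split=> // s st; rewrite ch//; exact: Hs.
Qed.

Let E_in h t : E h t `&` `[0, 1[ =
  if h 0%N == s0 then `[(cell h t).1, (cell h t).1 + (cell h t).2[%classic
  else set0.
Proof.
have ch x s : `[0, 1[%classic x -> chain s x = (chain_st x s).1.
  by rewrite /chain /= in_itv/= => ->.
apply/seteqP; split=> x.
  move=> [Ex x01]; have h0 : h 0%N = s0 by rewrite -(Ex 0%N)// ch.
  have x01' : 0 <= x < 1 by move: x01; rewrite /= in_itv.
  rewrite h0 eqxx /= in_itv/=; apply: (in_cell t x01' h0).1 => s st.
  by rewrite -ch//; exact: Ex.
case: eqP => //= h0; rewrite in_itv/= => xc.
have x01 : 0 <= x < 1.
  have [a b] := cell_bnd h t; move: xc => /andP[xa xb].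
  by rewrite (le_trans a xa) (lt_le_trans xb b).
split; last by rewrite in_itv.
by move=> s st; rewrite ch /= ?in_itv//; exact: (in_cell t x01 h0).2 xc s st.
Qed.

Let mE h t : measurable (E h t).
Proof.
rewrite -(setUIDK (E h t) `[0, 1[) E_in E_out.
by apply: measurableU; case: ifP => _ //; exact: measurableC.
Qed.

Let P : probability _ R := uniform_prob (@ltr01 R).

Let P_itv (a l : R) : 0 <= a -> 0 <= l -> a + l <= 1 ->
  P `[a, a + l[%classic = l%:E.
Proof.
move=> a0 l0 al; rewrite [LHS](@integral_uniform_pdf R 0 1).
rewrite setIidl => [|x]; last first.
  rewrite /= !in_itv/= => /andP[ax xl].
  by rewrite (le_trans a0 ax) (ltW (lt_le_trans xl al)).
rewrite (eq_integral (cst 1%E)); last first.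
  move=> x; rewrite inE /= in_itv/= /uniform_pdf => /andP[ax xl].
  by rewrite (le_trans a0 ax) (ltW (lt_le_trans xl al))/= subr0 invr1.
rewrite integral_cst//= mul1e lebesgue_measure_itv/= lte_fin ltrDl.
move: l0; rewrite le_eqVlt => /predU1P[<-|->]; first by rewrite ltxx.
by rewrite -EFinD addrC addKr.
Qed.

Let P_out : P (~` `[0, 1[%classic) = 0%E.
Proof.
rewrite probability_setC// -[X in `[_, X[]add0r P_itv ?add0r//.
by rewrite subee.
Qed.

Let P_E h t : P (E h t) = (if h 0%N == s0 then (cell h t).2 else 0)%:E.
Proof.
rewrite -(setUIDK (E h t) `[0, 1[) measureU; last 3 first.
- by apply: measurableI => //; exact: mE.
- by apply: measurableD => //; exact: mE.
- by rewrite setDE setIACA setICr setI0.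
rewrite [X in (_ + X)%E](_ : _ = 0%E); last first.
  by rewrite E_out; case: ifP => _; [exact: P_out|exact: measure0].
rewrite adde0 E_in; case: ifP => _; last exact: measure0.
by have [? ?] := cell_bnd h t; exact: P_itv.
Qed.

Lemma chain_exists : exists X : nat -> R -> S,
  [/\ forall t s, measurable [set x | X t x = s],
      P [set x | X 0%N x = s0] = 1%E &
      forall t (h : nat -> S),
      P [set x | forall s, (s <= t.+1)%N -> X s x = h s] =
      (P [set x | forall s, (s <= t)%N -> X s x = h s]
       * (K (h t) (h t.+1))%:E)%E].
Proof.
exists chain; split=> [t s||t h].
- have -> : [set x | chain t x = s] =
      \bigcup_(f in [set f : {ffun 'I_t.+1 -> S} | f ord_max = s])
         E (fun i => f (inord i)) t.
    apply/seteqP; split=> x /=.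
      move=> xs; exists [ffun i : 'I_t.+1 => chain i x]; first by rewrite /= ffunE.
      by move=> i it; rewrite ffunE inordK.
    move=> [f /= fs] /(_ t (leqnn t)) ->; rewrite -fs; congr (f _).
    by apply/val_inj; rewrite /= inordK.
  by apply: fin_bigcup_measurable => //; exact: finite_finset.
- have -> : [set x | chain 0 x = s0] = E (fun=> s0) 0.
    by apply/seteqP; split=> x /= H; [move=> s; rewrite leqn0 => /eqP->|exact: H].
  by rewrite P_E eqxx.
- by rewrite !P_E /=; case: ifP => _; rewrite ?mul0e// EFinM.
Qed.
End Chain.

(* For nonnegative weights the hypothesis [rzf_process] is satisfiable. *)
Lemma rzf_process_exists (R : realType) (V : finType) (w : V -> V -> R)
    (w_ge0 : forall u v, 0 <= w u v) (B0 : {set V}) :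
  exists B : nat -> R -> {set V}, rzf_process w (uniform_prob (@ltr01 R)) B0 B.
Proof.
have [B [mB initB transB]] :=
  chain_exists B0 (rzf_step_ge0 w_ge0) (rzf_step_sum w).
by exists B; split.
Qed.

End RzfExistence.

(* Main.v *)
(* Call u a right end of S if u is in S and u + 1 is not.  The expected number
   of vertices that turn blue in one round from S is the sum of w_uv / (p + q)
   over the edges leaving S; around the cycle, S has as many clockwise as
   counterclockwise outgoing edges, namely its number r(S) of right ends, so
   this sum is r(S) whatever p and q are.  An arc has r(S) <= 1, a property that
   every possible step preserves, and a nonempty S with r(S) = 0 is the whole
   cycle.  So E|B_(t+1)| = E|B_t| + P(B_t <> V), and summing over t,
   E tau = sum_t P(B_t <> V) = lim E|B_t| - k = n - k. *)
Require Import Defs.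
From HB Require Import structures.
From mathcomp Require Import all_boot all_order all_algebra.
From mathcomp Require Import all_classical all_reals all_analysis.
From mathcomp Require Import measurable_realfun ring lra.

Set Implicit Arguments.
Unset Strict Implicit.
Unset Printing Implicit Defensive.
Import Order.TTheory GRing.Theory Num.Theory.
Import numFieldNormedType.Exports.
Local Open Scope ring_scope.

Lemma natr_card (R : pzSemiRingType) (T : finType) (A : {pred T}) :
  #|A|%:R = \sum_x (x \in A)%:R :> R.
Proof.
rewrite -sum1_card natr_sum big_mkcond/=.
by apply: eq_bigr => x _; case: ifP.
Qed.

(** * One round of the process on an arbitrary weighted digraph *)

Section Step.
Context (R : realType) (V : finType) (w : V -> V -> R).

(** By linearity of expectation, it is enough to find the probability that a given vertex lies in
    the next set. Each such marginal comes from expanding a product of sums over all subsets. *)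
Lemma rzf_step_ex_card (B : {set V}) :
  \sum_B' rzf_step w B B' * #|B'|%:R =
  #|B|%:R + \sum_(v | v \notin B) blue_prob w B v.
Proof.
pose F v := if v \in B then 1 else blue_prob w B v.
pose G v := if v \in B then 0 else 1 - blue_prob w B v.
have FG v : F v + G v = 1.
  by rewrite /F /G; case: ifP => _; rewrite ?addr0// addrC subrK.
(* The factors 1 and 0 at blue vertices absorb the test [B \subset B']: a blue vertex missing from
   [B'] makes the product vanish. *)
have stepE B' : rzf_step w B B' = \prod_v (if v \in B' then F v else G v).
  rewrite [RHS](bigID (mem B))/= /rzf_step; case: ifPn => BB'.
    rewrite [X in X * _]big1 ?mul1r => [|v vB]; last first.
      by rewrite (fintype.subsetP BB' v vB) /F vB.
    by apply: eq_bigr => v /negbTE vB; rewrite /F /G vB.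
  have /subsetPn[v vB vB'] := BB'.
  by rewrite (bigD1 v)//= (negbTE vB') /G vB !mul0r.
have marginal v : \sum_B' rzf_step w B B' * (v \in B')%:R = F v.
  (* Replacing [G v] by 0 kills exactly the terms whose [B'] omits [v]. *)
  pose G' u := if u == v then 0 else G u.
  transitivity (\prod_u (F u + G' u)).
    rewrite bigA_distr; apply: eq_bigr => B' _; rewrite stepE.
    rewrite (bigD1 v)//= [RHS](bigD1 v)//= /G' eqxx.
    have [vB'|vB'] := boolP (v \in B'); rewrite ?mulr1 ?mulr0 ?mul0r//.
    by congr *%R; apply: eq_bigr => u /negbTE ->.
  rewrite (bigD1 v)//= /G' eqxx addr0 big1 ?mulr1// => u /negbTE ->.
  exact: FG.
under eq_bigr do rewrite natr_card mulr_sumr.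
rewrite exchange_big/=; under eq_bigr do rewrite marginal.
rewrite (bigID (mem B))/= -sum1_card natr_sum; congr +%R; apply: eq_bigr => v.
  by move=> vB; rewrite /F vB.
by move=> /negbTE vB; rewrite /F vB.
Qed.

Lemma rzf_step_neq0 (B B' : {set V}) : rzf_step w B B' != 0 ->
  B \subset B' /\
  forall v, v \in B' -> v \notin B -> blue_prob w B v != 0.
Proof.
rewrite /rzf_step; case: ifP => [BB'|]; last by rewrite eqxx.
move=> /prodf_neq0 H; split=> // v vB' vB; have := H v vB.
by rewrite vB'.
Qed.
End Step.

(** * Right ends of vertex sets on the cycle *)

Section Cycle.
Variables (n : nat).
Implicit Types (B S : {set 'I_n}) (u v : 'I_n).

Definition right_ends S : {set 'I_n} := [set u in S | ordS u \notin S].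

Lemma iter_ordS (u : 'I_n) j : val (iter j (@ordS n) u) = ((u + j) %% n)%N.
Proof.
elim: j => [|j IH] /=; first by rewrite addn0 modn_small.
by rewrite IH -addn1 modnDml addn1 addnS.
Qed.

(** Without right ends, [S] is closed under [ordS], and iterating [ordS] from any vertex reaches all
    of them. *)
Lemma right_ends_eq0 S :
  S != finset.set0 -> right_ends S = finset.set0 -> S = [set: 'I_n].
Proof.
move=> /finset.set0Pn[u uS] /finset.setP r0; apply/finset.setP => v.
rewrite finset.in_setT.
have iterS j : iter j (@ordS n) u \in S.
  elim: j => //= j IH; have := r0 (iter j (@ordS n) u).
  by rewrite !inE IH => /negbFE.
(* The number of steps avoids a truncated difference [v - u]: it leads from [u] to [v + n], which is
   [v] modulo [n]. *)
have -> : v = iter (v + (n - u)) (@ordS n) u by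
  apply/val_inj; rewrite iter_ordS addnCA subnKC ?modnDr ?modn_small// ltnW.
exact: iterS.
Qed.

Lemma right_ends_setT : right_ends [set: 'I_n] = finset.set0.
Proof. by apply/finset.setP => u; rewrite !inE. Qed.

Lemma card_right_ends S : S != finset.set0 -> (#|right_ends S| <= 1)%N ->
  #|right_ends S| = (S != [set: 'I_n]).
Proof.
move=> S0 r1; case: eqVneq => [->|ST]; first by rewrite right_ends_setT cards0.
apply/eqP; rewrite eqn_leq r1 card_gt0.
by apply: contra_neq ST => /(right_ends_eq0 S0).
Qed.

Lemma card_arc (a : 'I_n) k : (k <= n)%N -> #|cycle_arc a k| = k.
Proof.
move=> kn; rewrite card_imset ?card_ord// => i j /(congr1 val).
rewrite !iter_ordS => /eqP; rewrite eqn_modDl => /eqP.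
rewrite !modn_small ?(leq_trans (ltn_ord _) kn)//; exact: val_inj.
Qed.

(** Every vertex of the arc except the last has its successor in the arc. *)
Lemma right_ends_arc (a : 'I_n) k : (#|right_ends (cycle_arc a k)| <= 1)%N.
Proof.
case: k => [|k].
  rewrite (_ : right_ends _ = finset.set0) ?cards0//.
  apply/finset.setP => u; rewrite !inE.
  by apply/negbTE/negP => /andP[/imsetP[[]]].
rewrite -(cards1 (iter k (@ordS n) a)); apply: subset_leq_card.
apply/fintype.subsetP => u; rewrite !inE => /andP[/imsetP[j _ ->] jS].
case: (eqVneq (j : nat) k) => [->//|jk]; case/negP: jS.
have jk1 : (j.+1 < k.+1)%N by rewrite ltnS ltn_neqAle jk -ltnS ltn_ord.
by apply/imsetP; exists (Ordinal jk1).
Qed.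

Variables (R : realType) (p q : R).
Hypotheses (n3 : (3 <= n)%N) (p0 : 0 < p) (q0 : 0 < q).

(** Equality would give 2 = 0 modulo [n], which [3 <= n] excludes. Thus each vertex has two distinct
    in-neighbours, one for each weight. *)
Lemma ordS_neq_pred u : ordS u != ord_pred u.
Proof.
apply/eqP => /(congr1 (@ordS n)); rewrite ord_predK => /(congr1 val).
rewrite -[ordS (ordS u)]/(iter 2 (@ordS n) u) iter_ordS => /eqP.
rewrite -[X in _ == X](modn_small (ltn_ord u)) -[X in _ == (X %% _)%N]addn0.
by rewrite eqn_modDl mod0n modn_small.
Qed.

Lemma sum_bicycle S v : \sum_(u in S) bicycle p q u v =
  p * (ord_pred v \in S)%:R + q * (ordS v \in S)%:R.
Proof.
rewrite big_mkcond/= (bigD1 (ord_pred v))//= (bigD1 (ordS v)) ?ordS_neq_pred//=.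
rewrite big1 ?addr0 => [|u /andP[up uS]].
  congr +%R; rewrite /bicycle.
    by rewrite ord_predK eqxx; case: ifP; rewrite (mulr1, mulr0).
  rewrite ordSK eqxx (negbTE (_ : v != _)); last first.
    by rewrite -(can_eq (@ord_predK n)) ordSK eq_sym ordS_neq_pred.
  by case: ifP; rewrite (mulr1, mulr0).
rewrite /bicycle; case: ifP => // _; case: eqP => [vE|_].
  by rewrite vE ordSK eqxx in up.
by case: eqP => // vE; rewrite vE ord_predK eqxx in uS.
Qed.

Lemma blue_prob_bicycle S v : blue_prob (bicycle p q) S v =
  (p * (ord_pred v \in S)%:R + q * (ordS v \in S)%:R) / (p + q).
Proof.
rewrite /blue_prob.
have -> : \sum_u bicycle p q u v = p + q.
  rewrite (eq_bigl (mem [set: 'I_n])) => [|u]; last first.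
    by rewrite /= finset.in_setT.
  by rewrite sum_bicycle !finset.in_setT !mulr1.
by rewrite addr_gt0// sum_bicycle.
Qed.

(** Of the [#|S|] edges that start in [S] in either direction, the same number [c] stay inside [S].
    So [#|S| - c] edges leave in each direction, and the coefficients [p / (p + q)] and
    [q / (p + q)] add up to 1. *)
Lemma sum_blue_prob_bicycle S :
  \sum_(v | v \notin S) blue_prob (bicycle p q) S v = #|right_ends S|%:R.
Proof.
have pq : p + q != 0 by rewrite gt_eqF// addr_gt0.
pose c := \sum_v ((v \in S) && (ordS v \in S))%:R : R.
have cE : \sum_v ((v \in S) && (ord_pred v \in S))%:R = c.
  rewrite (reindex_inj (@ordS_inj n)); apply: eq_bigr => v _.
  by rewrite ordSK andbC.
have sS : \sum_v (ordS v \in S)%:R = #|S|%:R :> R.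
  by rewrite natr_card [RHS](reindex_inj (@ordS_inj n)).
have sP : \sum_v (ord_pred v \in S)%:R = #|S|%:R :> R.
  rewrite natr_card (reindex_inj (@ordS_inj n)).
  by under eq_bigr do rewrite ordSK.
have rE : #|right_ends S|%:R = #|S|%:R - c.
  apply/eqP; rewrite eq_sym subr_eq; apply/eqP.
  rewrite !natr_card -big_split/=; apply: eq_bigr => u _.
  by rewrite inE; case: (u \in S); case: (_ \in S); rewrite ?addr0 ?add0r.
transitivity (\sum_v (p / (p + q) * ((ord_pred v \in S)%:R
    - ((v \in S) && (ord_pred v \in S))%:R) + q / (p + q) * ((ordS v \in S)%:R
    - ((v \in S) && (ordS v \in S))%:R))).
  rewrite big_mkcond/=; apply: eq_bigr => v _; rewrite blue_prob_bicycle.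
  case: ifP => [/negbTE->|/negbFE->] /=; last by rewrite !subrr !mulr0 addr0.
  by rewrite !subr0; field.
rewrite big_split/= -!mulr_sumr !sumrB -/c cE sS sP rE.
by field.
Qed.

(** Each right end of [S'] comes from one of [S]. If it was already blue, it was a right end itself;
    if it is new, its successor is white, so it was coloured from its predecessor, which was a right
    end. *)
Lemma rzf_step_bicycle_ends S S' : rzf_step (bicycle p q) S S' != 0 ->
  S != finset.set0 -> (#|right_ends S| <= 1)%N ->
  S' != finset.set0 /\ (#|right_ends S'| <= 1)%N.
Proof.
move=> /rzf_step_neq0[SS' HS'] S0 r1; split.
  by apply: contra_neq S0 => S'0; apply/eqP; rewrite -finset.subset0 -S'0.
have ends u : u \in right_ends S' ->
    if u \in S then u \in right_ends S else ord_pred u \in right_ends S.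
  rewrite !inE => /andP[uS' usS'].
  have usS : ordS u \notin S by apply: contra usS'; exact: fintype.subsetP.
  case: ifPn => uS; first by rewrite uS.
  rewrite ord_predK uS andbT.
  have := HS' u uS' uS; rewrite blue_prob_bicycle (negbTE usS) mulr0 addr0.
  by case: (_ \in S) => //; rewrite mulr0 mul0r eqxx.
(* An old and a new right end cannot coexist: both would come from the same end of [S], so [v] would
   be the successor of [u] and lie in [S']. *)
have eqS u v : u \in S -> v \notin S -> u \in right_ends S' ->
    v \in right_ends S' -> u = v.
  move=> uS vS uR vR; have := ends v vR; have := ends u uR.
  rewrite uS (negbTE vS) => ur vr; have uv := card_le1_eqP r1 _ _ ur vr.
  by move: uR vR; rewrite !inE -uv ord_predK => /andP[_ /negbTE->].
apply/card_le1_eqP => u v ur vr.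
have [uS|uS] := boolP (u \in S); have [vS|vS] := boolP (v \in S).
- have := ends u ur; have := ends v vr; rewrite uS vS => *.
  exact: (card_le1_eqP r1).
- by apply/esym/eqS.
- exact: eqS.
- have := ends u ur; have := ends v vr.
  rewrite (negbTE uS) (negbTE vS) => vR uR.
  apply: (can_inj (@ord_predK n)); exact: (card_le1_eqP r1).
Qed.
End Cycle.

(** * Real-valued probabilities and finite partitions *)

Section Probability.
Local Open Scope classical_set_scope.
Context d (Omega : measurableType d) (R : realType) (P : probability Omega R).

Lemma probability_partition (F : finType) (Y : Omega -> F) (A : set Omega) :
  measurable A -> (forall f, measurable [set x | Y x = f]) ->
  fine (P A) = \sum_f fine (P (A `&` [set x | Y x = f])).
Proof.
move=> mA mY.
have mAY f : measurable (A `&` [set x | Y x = f]) by exact: measurableI.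
apply: EFin_inj; rewrite fineK ?fin_num_measure// -sumEFin.
under eq_bigr do rewrite fineK ?fin_num_measure//.
rewrite -big_enum/= fsbig_seq ?enum_uniq// -measure_fin_bigcup//=.
- congr (P _); apply/seteqP; split=> [x Ax|x [f _ []]//].
  by exists (Y x) => //=; rewrite mem_enum.
- by move=> f g _ _ [x [[_ /= <-] [_ /= <-]]].
Qed.

Lemma fine_probability_ge0 (A : set Omega) : 0 <= fine (P A).
Proof. by rewrite fine_ge0. Qed.

Lemma fine_probability_eq0 (A : set Omega) : measurable A ->
  (fine (P A) == 0) = (P A == 0%E).
Proof. by move=> mA; rewrite fine_eq0// fin_num_measure. Qed.

End Probability.

(** * Markov property and invariants of the process *)

Section Process.
Local Open Scope classical_set_scope.
Context d (Omega : measurableType d) (R : realType) (P : probability Omega R).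
Context (V : finType) (w : V -> V -> R) (B0 : {set V}).
Context (B : nat -> Omega -> {set V}) (hB : rzf_process w P B0 B).

Let pr (A : set Omega) : R := fine (P A).
Let mB t S : measurable [set x | B t x = S] := rzf_measurable hB t S.

Lemma measurable_rzf_pred t (Q : pred {set V}) : measurable [set x | Q (B t x)].
Proof.
rewrite [X in measurable X](_ : _ =
    \bigcup_(S in [set S | Q S]) [set x | B t x = S]).
  by apply: fin_bigcup_measurable => //; exact: finite_finset.
by apply/seteqP; split=> [x Qx|x [S QS /= ->]//]; exists (B t x).
Qed.

(** [rzf_trans] speaks of complete histories only; the one-step Markov rule follows by summing over
    the finitely many histories up to time [t]. *)
Lemma rzf_joint t S S' :
  pr ([set x | B t x = S] `&` [set x | B t.+1 x = S']) =
  pr [set x | B t x = S] * rzf_step w S S'.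
Proof.
pose Y x := [ffun i : 'I_t.+1 => B i x].
have mY f : measurable [set x | Y x = f].
  rewrite [X in measurable X](_ : _ =
      \bigcap_(i in [set: 'I_t.+1]) [set x | B i x = f i]).
    by apply: fin_bigcap_measurable => //; exact: finite_finset.
  apply/seteqP; split=> [x /= <- i _ /=|x /= H]; first by rewrite ffunE.
  by apply/ffunP => i; rewrite ffunE; exact: H.
rewrite /pr (@probability_partition _ _ _ _ _ (Y))//; last exact: measurableI.
rewrite [in RHS](@probability_partition _ _ _ _ _ (Y))// mulr_suml.
apply: eq_bigr => f _; have [fS|fS] := eqVneq (f ord_max) S; last first.
  have fS0 A : (A `&` [set x | B t x = S]) `&` [set x | Y x = f] = set0.
    apply/seteqP; split=> // x [[_ /= BS] Yf]; case/eqP: fS.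
    by rewrite -Yf ffunE.
  rewrite [X in X `&` _]setIC fS0 -[X in P (X `&` _)]setTI fS0.
  by rewrite measure0 mul0r.
(* The history [f] prolonged by [S'], so that [rzf_trans] applies at time [t]. *)
pose h s := if (s <= t)%N then f (inord s) else S'.
have YE x : Y x = f <-> forall s, (s <= t)%N -> B s x = h s.
  split=> [Yf s st|H]; first by rewrite /h st -Yf ffunE inordK.
  apply/ffunP => i; have it : (i <= t)%N by rewrite -ltnS.
  by rewrite ffunE H// /h it inord_val.
have fh : S = h t.
  by rewrite /h leqnn -fS; congr (f _); apply/val_inj; rewrite /= inordK.
have h' : S' = h t.+1 by rewrite /h ltnn.
have -> : [set x | B t x = S] `&` [set x | B t.+1 x = S'] `&` [set x | Y x = f]
    = [set x | forall s, (s <= t.+1)%N -> B s x = h s].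
  apply/seteqP; split=> [x [[_ /= BS'] /YE H] s|x /= H].
    rewrite leq_eqVlt => /predU1P[->|]; last exact: H.
    by rewrite BS'.
  split; last by apply/YE => s st; apply: H; exact: leqW.
  by split=> /=; rewrite H.
have YfE : [set x | Y x = f] = [set x | forall s, (s <= t)%N -> B s x = h s].
  by apply/seteqP; split=> x /YE.
rewrite setIidr => [|x /YE H]; last by rewrite /= H.
rewrite YfE.
by rewrite (rzf_trans hB) -fh -h' fineM// fin_num_measure// -YfE.
Qed.

Lemma rzf_marginal t S' :
  pr [set x | B t.+1 x = S'] =
  \sum_S pr [set x | B t x = S] * rzf_step w S S'.
Proof.
rewrite /pr (@probability_partition _ _ _ _ _ (B t))//.
by apply: eq_bigr => S _; rewrite -rzf_joint setIC.
Qed.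

Lemma rzf_init_neq S : S != B0 -> pr [set x | B 0 x = S] = 0.
Proof.
move=> SB0; have := probability_setC P (mB 0 B0).
rewrite (rzf_init hB) subee// => P0; rewrite /pr (_ : P _ = 0%E)//.
apply: subset_measure0 P0 => //; first exact: measurableC.
by move=> x /= ->; exact/eqP.
Qed.

(** If all predecessors of [S] with a possible step to [S] had probability 0, every term of
    [rzf_marginal] would vanish. *)
Lemma rzf_invariant (I : pred {set V}) : I B0 ->
  (forall S S', I S -> rzf_step w S S' != 0 -> I S') ->
  forall t S, pr [set x | B t x = S] != 0 -> I S.
Proof.
move=> I0 IS; elim=> [|t IH] S.
  by have [->//|/rzf_init_neq->] := eqVneq S B0; rewrite eqxx.
rewrite rzf_marginal => /eqP S0; apply/negPn/negP => nI; case: S0.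
apply: big1 => S1 _; apply/eqP; rewrite mulf_eq0.
apply: contraNT nI; rewrite negb_or => /andP[/IH I1]; exact: IS.
Qed.

(** * Tail sums for the propagation time *)

Let white t := [set x | B t x != [set: V]%SET].
(** The event that the propagation time exceeds [t]. *)
Let unfinished t := [set x | forall s, (s <= t)%N -> B s x != [set: V]%SET].
Let mean_card t : R := \sum_S pr [set x | B t x = S] * #|S|%:R.

Let m_white t : measurable (white t).
Proof. exact: (measurable_rzf_pred t (fun S => S != [set: V]%SET)). Qed.

Let m_unfinished t : measurable (unfinished t).
Proof.
rewrite [X in measurable X](_ : _ = \bigcap_(s in `I_t.+1) white s).
  by apply: fin_bigcap_measurable => //; exact: finite_II.
by [].
Qed.

Lemma pr_white t : pr (white t) =
  \sum_S pr [set x | B t x = S] * (S != [set: V]%SET)%:R.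
Proof.
rewrite /pr (@probability_partition _ _ _ _ _ (B t))//; apply: eq_bigr => S _.
case: eqP => [->|/eqP ST]; rewrite ?mulr0 ?mulr1.
  rewrite (_ : _ `&` _ = set0) ?measure0//.
  by apply/seteqP; split=> // x [/= /eqP].
congr (fine (P _)); apply/seteqP; split=> [x []//|x /= BS].
by split=> //; rewrite /white /= BS.
Qed.

(* [set: V] is absorbing, so [B s] can be white-free for some s <= t while
   [B t] is not only with probability 0. *)
Let pr_unfinished t : P (unfinished t) = P (white t).
Proof.
have sub t' : unfinished t' `<=` white t' by move=> x; exact.
suff neg : P.-negligible (white t `\` unfinished t).
  rewrite (measureDI _ (m_white t) (m_unfinished t)).
  rewrite [X in (X + _)%E](_ : _ = 0%E) ?add0e; last first.
    by apply: measure_negligible => //; exact: measurableD.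
  by congr (P _); apply/esym/setIidPr.
elim: t => [|t IH].
  rewrite (_ : _ `\` _ = set0); first exact: negligible_set0.
  apply/seteqP; split=> // x [/= Wx]; apply.
  by move=> s; rewrite leqn0 => /eqP->.
have stay : P.-negligible (white t.+1 `&` [set x | B t x = [set: V]%SET]).
  have mW : measurable (white t.+1 `&` [set x | B t x = [set: V]%SET]).
    exact: measurableI.
  apply/negligibleP => //; apply/eqP; rewrite -fine_probability_eq0//.
  rewrite (@probability_partition _ _ _ _ _ (B t.+1))//; apply/eqP/big1 => S' _.
  have [->|S'T] := eqVneq S' [set: V]%SET.
    rewrite (_ : _ `&` _ = set0) ?measure0//.
    by apply/seteqP; split=> // x [[/= /eqP]].
  transitivity
    (pr ([set x | B t x = [set: V]%SET] `&` [set x | B t.+1 x = S'])).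
    congr (fine (P _)); apply/seteqP; split=> [x [[] //]|x [/= BT BS]].
    by split=> //; split=> //; rewrite /white /= BS.
  by rewrite rzf_joint /rzf_step finset.subTset (negbTE S'T) mulr0.
(* A path that is white at [t.+1] but was full earlier either leaves the full set right after [t],
   or is already exceptional at time [t]. *)
apply: negligibleS (negligibleU stay IH) => x [/= Wx Ux].
have [BT|BT] := eqVneq (B t x) [set: V]%SET; [by left|right].
split=> // H; apply: Ux => s; rewrite leq_eqVlt => /predU1P[->//|].
exact: H.
Qed.

(** The pathwise tail-sum formula, valid also for an infinite propagation time: all indicators are
    then 1 and the partial sums exceed every real bound. *)
Let prop_timeE x : prop_time R B x =
  (\sum_(0 <= t <oo) (\1_(unfinished t) x)%:E)%E.
Proof.
have [[t Bt]|nB] := pselect (exists t, B t x = [set: V]%SET); last first.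
  rewrite /prop_time [X in ereal_inf (_ @` X)](_ : _ = set0); last first.
    by apply/seteqP; split=> // t Bt; case: nB; exists t.
  rewrite image_set0 ereal_inf0; apply/esym/eqyP => A A0.
  have [k Ak] : exists k : nat, A <= k%:R.
    by exists (Num.truncn A).+1; rewrite ltW// truncnS_gt.
  apply: le_trans (nneseries_lim_ge k _) => [|i _]; last by rewrite lee_fin.
  rewrite sumEFin lee_fin (le_trans Ak)//.
  rewrite (eq_bigr (fun=> 1)) ?sumr_const_nat ?subn0// => i _.
  rewrite indicE mem_set// => s _; apply/eqP => Bs; apply: nB; by exists s.
have exT : exists t, B t x == [set: V]%SET by exists t; apply/eqP.
case: (ex_minnP exT) => m /eqP Bm mmin.
have indE s : \1_(unfinished s) x = (s < m)%:R :> R.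
  rewrite indicE; congr ((nat_of_bool _)%:R); apply/idP/idP; rewrite inE.
    by move=> Us; rewrite ltnNge; apply/negP => /Us; rewrite Bm eqxx.
  move=> sm s' s's; apply/negP => /mmin; rewrite leqNgt.
  by rewrite (leq_ltn_trans s's sm).
have -> : prop_time R B x = m%:R%:E.
  apply/eqP; rewrite eq_le; apply/andP; split.
    by apply: ge_ereal_inf; exists m%:R%:E => //; exists m.
  apply/ereal_infP => _ [s /= Bs <-]; rewrite lee_fin ler_nat mmin//.
  exact/eqP.
rewrite (nneseries_split 0 m) => [|s _]; last by rewrite lee_fin.
rewrite add0n eseries0 ?adde0 => [|s ms _]; last first.
  by rewrite indE ltnNge ms.
rewrite sumEFin (eq_big_nat _ _ (F2 := fun=> 1)) => [|s /andP[_ sm]].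
  by rewrite sumr_const_nat subn0.
by rewrite indE sm.
Qed.

(** Nonnegative terms allow the sum and the integral to be exchanged; [pr_unfinished] then replaces
    tail events by events at a single time. *)
Let integral_prop_time :
  (\int[P]_x prop_time R B x = \sum_(0 <= t <oo) P (white t))%E.
Proof.
under eq_integral do rewrite prop_timeE.
rewrite integral_nneseries//.
- apply: eq_eseriesr => t _.
  by rewrite integral_indic// setIT; exact: pr_unfinished.
- by move=> t; apply/measurable_EFinP/measurable_indic.
Qed.

Let pr_total t : \sum_S pr [set x | B t x = S] = 1.
Proof.
have -> : 1 = fine (P setT) by rewrite probability_setT.
rewrite (@probability_partition _ _ _ _ _ (B t))//.
by apply: eq_bigr => S _; rewrite setTI.
Qed.

(** With drift 1 until completion, the mean blue count grows by [e t] in each round, so the tail sum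
    telescopes. *)
Lemma ept_rzf_unit_drift (I : pred {set V}) : I B0 ->
  (forall S S', I S -> rzf_step w S S' != 0 -> I S') ->
  (forall S, I S -> \sum_(v | v \notin S) blue_prob w S v =
                    (S != [set: V]%SET)%:R) ->
  ept_rzf P B = (#|V|%:R - #|B0|%:R)%:E.
Proof.
move=> I0 IS drift; pose e t := pr (white t).
have mean0 : mean_card 0 = #|B0|%:R.
  rewrite /mean_card (bigD1 B0)//= big1 => [|S /rzf_init_neq->].
    by rewrite addr0 /pr (rzf_init hB) mul1r.
  by rewrite mul0r.
have meanS t : mean_card t.+1 = mean_card t + e t.
  rewrite /mean_card; under eq_bigr do rewrite rzf_marginal mulr_suml.
  rewrite exchange_big /e pr_white -big_split/=; apply: eq_bigr => S _.
  under eq_bigr do rewrite -mulrA.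
  rewrite -mulr_sumr rzf_step_ex_card -mulrDr.
  (* The drift is known only on states satisfying [I]; all others have probability 0. *)
  have [->|/(rzf_invariant I0 IS) IS'] := eqVneq (pr [set x | B t x = S]) 0.
    by rewrite !mul0r.
  by rewrite drift.
have seriesE T : series e T = mean_card T - #|B0|%:R.
  elim: T => [|T IH]; first by rewrite mean0 subrr /series/= big_geq.
  by rewrite seriesSr IH meanS addrAC.
have defectE t : #|V|%:R - mean_card t =
    \sum_S pr [set x | B t x = S] * (#|V|%:R - #|S|%:R).
  under eq_bigr do rewrite mulrBr.
  by rewrite sumrB -mulr_suml pr_total mul1r.
(* The number of white vertices is 0 on the full set and at most [#|V|] otherwise. *)
have defect t : 0 <= #|V|%:R - mean_card t <= #|V|%:R * e t.
  rewrite defectE; apply/andP; split.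
    apply: sumr_ge0 => S _; rewrite mulr_ge0 ?fine_probability_ge0//.
    by rewrite subr_ge0 ler_nat max_card.
  rewrite /e pr_white mulr_sumr; apply: ler_sum => S _.
  rewrite mulrCA ler_wpM2l ?fine_probability_ge0//.
  case: eqP => [->|_]; first by rewrite cardsT subrr mulr0.
  by rewrite mulr1 gerBl.
have e_ge0 t : 0 <= e t by exact: fine_probability_ge0.
(* The partial sums of [e] are bounded by [#|V| - #|B0|], so the series converges and its terms tend
   to 0. By [defect], the mean blue count then tends to [#|V|]. *)
have cvg_e : e @ \oo --> 0.
  apply: cvg_series_cvg_0; apply: nondecreasing_is_cvgn.
    by apply/nondecreasing_seqP => T; rewrite seriesSr lerDl.
  exists (#|V|%:R - #|B0|%:R) => _ [T _ <-]; rewrite seriesE lerB//.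
  by have /andP[] := defect T; rewrite subr_ge0.
have cvg_series : series e @ \oo --> (#|V|%:R - #|B0|%:R : R).
  apply: (@squeeze_cvgr _ _ _ _
      (fun t => #|V|%:R - #|B0|%:R - #|V|%:R * e t)
      (fun=> #|V|%:R - #|B0|%:R)).
  - apply: nearW => t; have := defect t; rewrite seriesE => /andP[d0 d1].
    by apply/andP; split; lra.
  - have := cvgB (cvg_cst (#|V|%:R - #|B0|%:R : R))
                 (cvgM (cvg_cst (#|V|%:R : R)) cvg_e).
    by rewrite mulr0 subr0; exact.
  - exact: cvg_cst.
(* This selects the integral branch of [ept_rzf]: at a time with [e t < 1], the full set has
   positive probability. *)
have exT : exists t, (0 < P [set x | B t x = [set: V]%SET])%E.
  have [t _ /(_ t (leqnn t)) /= et1] := cvgr_lt _ cvg_e _ ltr01.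
  exists t; rewrite lt0e measure_ge0 andbT; apply/eqP => PT.
  suff : e t = 1 by move=> e1; rewrite e1 ltxx in et1.
  rewrite -(pr_total t) /e pr_white; apply: eq_bigr => S _.
  by case: eqP => [->|]; rewrite ?mulr1// /pr PT mul0r.
rewrite /ept_rzf asboolT// integral_prop_time.
under eq_eseriesr => t _ do rewrite -(fineK (fin_num_measure P _ (m_white t))).
apply: cvg_lim => //; under eq_fun do rewrite sumEFin.
by apply: cvg_EFin; [exact: nearW|exact: cvg_series].
Qed.

End Process.

Theorem theorem3p3 (R : realType) (n k : nat) (hn : (3 <= n)%N)
    (hk : (1 <= k <= n)%N) (a : 'I_n) (p q : R) (hp : 0 < p) (hq : 0 < q)
    (d : measure_display) (Omega : measurableType d) (P : probability Omega R)
    (B : nat -> Omega -> {set 'I_n})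
    (hB : rzf_process (bicycle p q) P (cycle_arc a k) B) :
  ept_rzf P B = (n%:R - k%:R)%:E /\
  (forall (p' q' : R) (d' : measure_display) (Omega' : measurableType d')
     (P' : probability Omega' R) (B' : nat -> Omega' -> {set 'I_n}),
     0 < p' -> 0 < q' -> rzf_process (bicycle p' q') P' (cycle_arc a k) B' ->
     ept_rzf P' B' = ept_rzf P B).
Proof.
have ept (p' q' : R) d' (Omega' : measurableType d') (P' : probability Omega' R)
    B' : 0 < p' -> 0 < q' ->
    rzf_process (bicycle p' q') P' (cycle_arc a k) B' ->
    ept_rzf P' B' = (n%:R - k%:R)%:E.
  move=> p'0 q'0 hB'; have /andP[k1 kn] := hk.
  (* The invariant describes arcs, the whole cycle included, without naming their endpoints. *)
  rewrite (ept_rzf_unit_drift hB'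
    (I := fun S => (S != finset.set0) && (#|right_ends S| <= 1)%N)).
  - by rewrite card_ord card_arc.
  - by rewrite right_ends_arc andbT -card_gt0 card_arc.
  - move=> S S' /andP[S0 r1] SS'; apply/andP.
    exact: rzf_step_bicycle_ends SS' S0 r1.
  - by move=> S /andP[S0 r1]; rewrite sum_blue_prob_bicycle// card_right_ends.
split; first exact: ept hB.
move=> p' q' d' Omega' P' B' p'0 q'0 hB'.
rewrite (ept _ _ _ _ _ _ hp hq hB).
exact: ept hB'.
Qed.
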